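(* Interpolation of the form $\varphi\vdash\alpha\mathrel{|\!\sim}\psi$ exists when $\mathrel{|\!\sim}$ is defined by a smooth Hamming relation, more precisely by a smooth relation satisfying (GH3). That is, if $\preceq$ is smooth and satisfies (GH3), and $\varphi,\psi$ are formulas with $\mu(M(\varphi))\subseteq M(\psi)$, then there is a formula $\alpha$ containing only propositional variables occurring in both $\varphi$ and $\psi$ such that $M(\varphi)\subseteq M(\alpha)$ and $\mu(M(\alpha))\subseteq M(\psi)$.
   Context: Classical two-valued propositional language with set of variables $L$ and constants TRUE, FALSE; $M(\varphi)\subseteq\{0,1\}^L$ is the set of models of $\varphi$. For $Y\subseteq L$ let $\Pi_Y=\{0,1\}^Y$; for disjoint $Y',Y''$ identify $\Pi_{Y'\cup Y''}$ with $\Pi_{Y'}\times\Pi_{Y''}$ and write elements as $\sigma'\sigma''$. On every $\Pi_Y$ ($Y\subseteq L$) a reflexive relation $\preceq$ is given; $\sigma\prec\tau$ iff $\sigma\preceq\tau$ and $\sigma\neq\tau$. For $A\subseteq\Pi_Y$, $\mu(A)=\{a\in A:\neg\exists b\in A\; b\prec a\}$. $\preceq$ is smooth if for every $Y$, every definable $A\subseteq\Pi_Y$ (i.e. $A$ is the set of models of some set of formulas in the variables $Y$) and every $a\in A$, either $a\in\mu(A)$ or there is $b\in\mu(A)$ with $b\prec a$. (GH3): for all disjoint $Y',Y''\subseteq L$, $\sigma',\tau'\in\Pi_{Y'}$, $\sigma'',\tau''\in\Pi_{Y''}$: $\sigma'\sigma''\preceq\tau'\tau''$ iff $\sigma'\preceq\tau'$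 and $\sigma''\preceq\tau''$. $\mathrel{|\!\sim}$ is defined by: $\beta\mathrel{|\!\sim}\gamma$ iff $\mu(M(\beta))\subseteq M(\gamma)$. *)

(* Defs.v *)
From mathcomp Require Import all_boot all_classical.

Set Implicit Arguments.
Unset Strict Implicit.
Unset Printing Implicit Defensive.

Local Open Scope classical_set_scope.

Inductive formula (L : Type) : Type :=
| Var of L
| TRUE
| FALSE
| Neg of formula L
| And of formula L & formula L
| Or of formula L & formula L
| Imp of formula L & formula L.

Arguments TRUE {L}.
Arguments FALSE {L}.

Fixpoint vars (L : Type) (f : formula L) : set L :=
  match f with
  | Var x => [set x]
  | TRUE | FALSE => set0
  | Neg g => vars g
  | And g h | Or g h | Imp g h => vars g `|` vars h
  end.

Fixpoint eval (L : Type) (v : L -> bool) (f : formula L) : bool :=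
  match f with
  | Var x => v x
  | TRUE => true
  | FALSE => false
  | Neg g => ~~ eval v g
  | And g h => eval v g && eval v h
  | Or g h => eval v g || eval v h
  | Imp g h => eval v g ==> eval v h
  end.

(* {0,1}^Y; the domain is the subtype of L associated with Y. *)
Definition Pi (L : Type) (Y : set L) : Type := set_type Y -> bool.

(* The value [false] outside Y is a dummy: [extend s] is only used to evaluate
   variables of Y. *)
Definition extend (L : Type) (Y : set L) (s : Pi Y) (x : L) : bool :=
  if insub x is Some y then s y else false.

(* The element s's'' of {0,1}^(Y' U Y''), meant for disjoint Y' and Y''. *)
Definition join (L : Type) (Y' Y'' : set L) (s' : Pi Y') (s'' : Pi Y'') :
    Pi (Y' `|` Y'') :=
  fun x => if insub (val x) is Some y then s' y else extend s'' (val x).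

(* Meaningful when [vars f `<=` Y]. *)
Definition models_on (L : Type) (Y : set L) (f : formula L) : set (Pi Y) :=
  [set s | eval (extend s) f].
Arguments models_on {L} Y f _.

(* {0,1}^L is [Pi [set: L]]. *)
Definition M (L : Type) (f : formula L) : set (Pi [set: L]) :=
  models_on [set: L] f.

Definition definable (L : Type) (Y : set L) (A : set (Pi Y)) : Prop :=
  exists2 G : set (formula L), (forall f, G f -> vars f `<=` Y) &
    A = [set s | forall f, G f -> models_on Y f s].

Definition relation_family (L : Type) : Type :=
  forall Y : set L, Pi Y -> Pi Y -> Prop.

Section Relations.
Variables (L : Type) (le : relation_family L).

Definition reflexive_family : Prop := forall (Y : set L) (s : Pi Y), le s s.

Definition prec (Y : set L) (s t : Pi Y) : Prop := le s t /\ s <> t.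

Definition mu (Y : set L) (A : set (Pi Y)) : set (Pi Y) :=
  [set a | A a /\ ~ exists2 b, A b & prec b a].

Definition smooth : Prop :=
  forall (Y : set L) (A : set (Pi Y)), definable A ->
  forall a, A a -> mu A a \/ exists2 b, mu A b & prec b a.

Definition GH3 : Prop :=
  forall Y' Y'' : set L, Y' `&` Y'' = set0 ->
  forall (s' t' : Pi Y') (s'' t'' : Pi Y''),
    le (join s' s'') (join t' t'') <-> le s' t' /\ le s'' t''.

Definition nmcons (f g : formula L) : Prop := mu (M f) `<=` M g.

End Relations.

(* Main.v *)
Require Import Defs.
From mathcomp Require Import all_boot all_classical.

(** Since [phi |- alpha], the natural candidate for [alpha] is the strongest
    consequence of [phi] in the common variables, obtained by forgetting the
    variables of [A = vars phi `\` vars psi]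
    ([forgettable_vars]).  It remains to see that a minimal model [s] of [alpha] satisfies [psi].

    Put [J = vars phi] and [B = vars phi `&` vars psi].  Under GH3 a valuation
    is a minimal model of a formula with variables in [J] if and only if its
    [J]-part is a minimal model and its remaining part is minimal among all
    valuations of the other variables ([mu_M_restr]).  So both parts of [s] are
    minimal in this sense, the first one for [alpha].  As [s] satisfies [alpha],
    changing it on [A] gives a model [t] of [phi], and smoothness over the
    variables [J] gives a minimal model [r] of [phi] below [t].
    By GH3, [r] is below [s] on [B]; replacing the [B]-part of [s] by that of
    [r] yields a model of [alpha] below [s] on [J], so [r] and [s] agree on [B].
    Let [w] be [r] on [J] and [s] outside [J].  Both parts of [w] are minimal,
    so [w] is a minimal model of [phi] and satisfies [psi]; and [s] agrees with
    [w] on [vars psi].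

    All comparisons are made between restrictions of total valuations
    [L -> bool]: this turns the identification of [Pi (Y' `|` Y'')] with
    [Pi Y' * Pi Y''] into an identity between restrictions of a single
    valuation, and GH3 into lemma [le_split]. *)

Set Implicit Arguments.
Unset Strict Implicit.
Unset Printing Implicit Defensive.

Local Open Scope classical_set_scope.

(** * Restrictions of total valuations *)

Section Valuations.
Variable L : Type.
Implicit Types (Y : set L) (u v : L -> bool) (f g : formula L).

Definition restr Y u : Pi Y := fun x => u (val x).
Arguments restr Y u _ : clear implicits.

Definition glue Y u v : L -> bool := fun x => if x \in Y then u x else v x.

Lemma extend_restr Y u x : Y x -> extend (restr Y u) x = u x.
Proof.
move=> Yx; rewrite /extend; case: insubP => [y _ <-//|].
by rewrite (mem_set Yx).
Qed.

Lemma restr_extend Y (s : Pi Y) : restr Y (extend s) = s.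
Proof.
by apply/funext => y; rewrite /restr /extend valK.
Qed.

Lemma restr_eqP Y u v : restr Y u = restr Y v <-> {in Y, u =1 v}.
Proof.
split=> [uv x Yx|uv]; last by apply/funext => y; apply/uv/valP.
by have := congr1 (fun s => s (Sub x Yx)) uv; rewrite /restr SubK.
Qed.

Lemma restrT_inj u v : restr [set: L] u = restr [set: L] v -> u =1 v.
Proof. by move=> /restr_eqP uv x; apply: uv; rewrite in_setT. Qed.

Lemma restr_glueS Y Y' u v : Y' `<=` Y -> restr Y' (glue Y u v) = restr Y' u.
Proof.
move=> YY; apply/restr_eqP => x /set_mem/YY Yx.
by rewrite /glue mem_set.
Qed.

Lemma restr_glueC Y Y' u v : Y' `<=` ~` Y ->
  restr Y' (glue Y u v) = restr Y' v.
Proof.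
move=> YY; apply/restr_eqP => x /set_mem/YY nYx.
by rewrite /glue memNset.
Qed.

Lemma join_restr Y Y' u : join (restr Y u) (restr Y' u) = restr (Y `|` Y') u.
Proof.
apply/funext => x; rewrite /join /restr; case: insubP => [y _ <-//|/negP xY].
apply: extend_restr; case: (set_mem (valP x)) => // Yx.
by case: xY; rewrite mem_set.
Qed.

Lemma eq_eval f u v : {in vars f, u =1 v} -> eval u f = eval v f.
Proof.
elim: f => [x|||g IHg|g IHg h IHh|g IHg h IHh|g IHg h IHh] //= uv.
- by apply: uv; rewrite mem_set.
- by rewrite IHg.
all: rewrite IHg ?IHh // => x /set_mem xf; apply/uv/mem_set; by [left|right].
Qed.

Lemma models_on_restr Y f u : vars f `<=` Y ->
  models_on Y f (restr Y u) = eval u f :> Prop.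
Proof.
move=> fY; rewrite /models_on /=; congr is_true.
by apply: eq_eval => x /set_mem/fY /extend_restr ->.
Qed.

Lemma M_restr f u : M f (restr [set: L] u) = eval u f :> Prop.
Proof. exact: models_on_restr. Qed.

Lemma definable_models_on Y f : vars f `<=` Y -> definable (models_on Y f).
Proof.
move=> fY; exists [set f] => [_ ->//|].
by apply/seteqP; split => s /= => [fs _ ->|/(_ f erefl)].
Qed.

(** * Forgetting variables *)

Fixpoint subst (x : L) (c : formula L) f : formula L :=
  match f with
  | Var y => if pselect (y = x) then c else Var y
  | TRUE => TRUE
  | FALSE => FALSE
  | Neg g => Neg (subst x c g)
  | And g h => And (subst x c g) (subst x c h)
  | Or g h => Or (subst x c g) (subst x c h)
  | Imp g h => Imp (subst x c g) (subst x c h)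
  end.

Lemma vars_subst x c f : vars c = set0 -> vars (subst x c f) `<=` vars f `\ x.
Proof.
move=> c0; elim: f => [y|||g IHg|g IHg h IHh|g IHg h IHh|g IHg h IHh] //=.
  by case: pselect => yx /=; [rewrite c0|move=> _ ->].
all: by rewrite setDUl; apply: setUSS.
Qed.

Lemma eval_subst x c f v :
  eval v (subst x c f) = eval (glue [set x] (fun=> eval v c) v) f.
Proof.
elim: f => [y|||g IHg|g IHg h IHh|g IHg h IHh|g IHg h IHh] //=; last first.
1-4: by rewrite ?IHg ?IHh.
rewrite /glue; case: pselect => yx; first by rewrite mem_set.
by rewrite memNset.
Qed.

(** Elimination of a propositional quantifier over the variables in [A].  The
    property quantifies over all formulas so as to be stable under unions. *)
Definition forgettable (A : set L) : Prop :=
  forall f, exists2 g, vars g `<=` vars f `\` A &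
    forall v, eval v g <-> exists2 u, {in ~` A, u =1 v} & eval u f.

Lemma forgettable0 : forgettable set0.
Proof.
move=> f; exists f => [|v]; first by rewrite setD0.
split=> [fv|[u uv]]; first by exists v.
by rewrite (@eq_eval f u v) // => x _; apply: uv; rewrite setC0 in_setT.
Qed.

(** A variable takes only two values, so quantifying over it is a
    disjunction. *)
Lemma forgettable1 x : forgettable [set x].
Proof.
move=> f; exists (Or (subst x TRUE f) (subst x FALSE f)) => [|v /=].
  by move=> y [] /vars_subst; apply.
rewrite !eval_subst /=; split=> [/orP[] fv|[u uv fu]].
- exists (glue [set x] (fun=> true) v) => //.
  by apply/restr_eqP; rewrite restr_glueC.
- exists (glue [set x] (fun=> false) v) => //.
  by apply/restr_eqP; rewrite restr_glueC.
have uE : u = glue [set x] (fun=> u x) v.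
  apply/funext => y; rewrite /glue; case: ifPn => [/set_mem -> //|].
  by rewrite -in_setC => /uv.
by move: fu; rewrite uE; case: (u x) => ->; rewrite ?orbT.
Qed.

Lemma forgettableU A B : forgettable A -> forgettable B ->
  forgettable (A `|` B).
Proof.
move=> fA fB f; have [g gf gP] := fA f; have [h hg hP] := fB g.
exists h => [x /hg [/gf [fx nAx] nBx]|v]; first by split=> // -[].
rewrite hP; split=> [[u uv /gP[w wu fw]]|[w wv fw]].
  exists w => // x /set_mem; rewrite setCU => -[nAx nBx].
  by rewrite wu ?uv ?mem_set.
exists (glue A v w).
  move=> x /set_mem nBx; rewrite /glue; case: ifPn => // /negP nAx.
  by apply/wv/mem_set => -[/mem_set|].
by apply/gP; exists w => //; apply/restr_eqP; rewrite restr_glueC.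
Qed.

(** Recursion on [f] stands for the finiteness of its set of variables. *)
Lemma forgettable_vars f A : forgettable (A `&` vars f).
Proof.
elim: f => [x|||g IHg|g IHg h IHh|g IHg h IHh|g IHg h IHh] /=.
- have [Ax|nAx] := pselect (A x).
    suff -> : A `&` [set x] = [set x] by exact: forgettable1.
    by apply/setIidPr => _ ->.
  suff -> : A `&` [set x] = set0 by exact: forgettable0.
  by apply/seteqP; split=> // y [Ay yx]; apply: nAx; rewrite -yx.
- by rewrite setI0; exact: forgettable0.
- by rewrite setI0; exact: forgettable0.
- exact: IHg.
all: by rewrite setIUr; exact: forgettableU.
Qed.

End Valuations.

Arguments restr {L} Y u _.

(** * Minimality under GH3 *)

Section Interpolation.
Variables (L : Type) (le : relation_family L).
Implicit Types (Y : set L) (u v : L -> bool) (f : formula L).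

(** GH3 for restrictions of total valuations: any [Y' `<=` Y] splits [Y] into
    two disjoint sets, on which the two comparisons are independent. *)
Lemma le_split : GH3 le -> forall Y Y' u v, Y' `<=` Y ->
  le (restr Y u) (restr Y v) <->
  le (restr Y' u) (restr Y' v) /\ le (restr (Y `\` Y') u) (restr (Y `\` Y') v).
Proof.
move=> le_GH3 Y Y' u v YY.
have := le_GH3 Y' (Y `\` Y') (setDIK Y' Y) (restr Y' u) (restr Y' v).
move=> /(_ (restr _ u) (restr _ v)).
by rewrite !join_restr setDUK.
Qed.

Lemma mu_restr Y f u : vars f `<=` Y ->
  mu le (models_on Y f) (restr Y u) <->
  eval u f /\ forall v, eval v f -> le (restr Y v) (restr Y u) ->
                        {in Y, v =1 u}.
Proof.
move=> fY; rewrite /mu /= models_on_restr //; split=> -[fu min]; split=> //.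
  move=> v fv vu; apply/restr_eqP; apply: contrapT => nvu; apply: min.
  by exists (restr Y v) => //; rewrite models_on_restr.
move=> [s]; rewrite -(restr_extend s) models_on_restr // => fs [su].
by apply; apply/restr_eqP/min.
Qed.

Hypotheses (le_refl : reflexive_family le) (le_GH3 : GH3 le).

Lemma smooth_le Y f u : smooth le -> vars f `<=` Y -> eval u f ->
  exists2 v, mu le (models_on Y f) (restr Y v) & le (restr Y v) (restr Y u).
Proof.
move=> le_smooth fY fu.
have := le_smooth _ _ (definable_models_on fY) (restr Y u).
rewrite models_on_restr // => /(_ fu)[?|[s mus [su _]]]; first by exists u.
by exists (extend s); rewrite restr_extend.
Qed.

(** The set of models is the product of the models over [Y] with all valuations
    of [~` Y], and under GH3 the minimal elements of a product are the pairs of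
    minimal elements: by reflexivity, a strict decrease in one component is a
    strict decrease of the pair. *)
Lemma mu_M_restr Y f u : vars f `<=` Y ->
  mu le (M f) (restr [set: L] u) <->
  mu le (models_on Y f) (restr Y u) /\
  forall v, le (restr (~` Y) v) (restr (~` Y) u) -> {in ~` Y, v =1 u}.
Proof.
move=> fY; rewrite !mu_restr //; split=> [[fu min]|[[fu minY] minC]].
  split; [split=> // v fv vu x Yx|move=> v vu x nYx].
    rewrite -(min (glue Y v u)) ?in_setT // /glue ?Yx //.
    rewrite (@eq_eval _ _ _ v) // => y /set_mem/fY Yy.
      by rewrite mem_set.
    apply/(le_split le_GH3 (Y' := Y)) => //; rewrite setTD.
    by rewrite restr_glueS // restr_glueC.
  rewrite -(min (glue Y u v)) ?in_setT // /glue.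
  - by rewrite memNset //; exact: set_mem.
  - by rewrite (@eq_eval _ _ _ u) // => y /set_mem/fY Yy; rewrite mem_set.
  apply/(le_split le_GH3 (Y' := Y)) => //; rewrite setTD.
  by rewrite restr_glueS // restr_glueC.
split=> // v fv /(le_split le_GH3 (Y' := Y) v u (@subsetT _ _)); rewrite setTD.
move=> [vuY vuC] x _; have [Yx|nYx] := boolP (x \in Y).
  exact: (minY v).
by apply: (minC v) => //; rewrite in_setC.
Qed.

End Interpolation.

(** * Interpolation *)

Theorem corollary5p3p4 (L : Type) (le : relation_family L)
    (le_refl : reflexive_family le) (le_smooth : smooth le) (le_GH3 : GH3 le)
    (phi psi : formula L) (phi_psi : nmcons le phi psi) :
  exists alpha : formula L,
    [/\ vars alpha `<=` vars phi `&` vars psi,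
        M phi `<=` M alpha &
        nmcons le alpha psi].
Proof.
pose J := vars phi; pose B := J `&` vars psi.
have [alpha alphaB0 alphaP] := forgettable_vars phi (~` vars psi) phi.
have alphaB : vars alpha `<=` B.
  by move=> x /alphaB0 [Jx nx]; split=> //; apply: contrapT => npx; apply: nx.
have alphaJ : vars alpha `<=` J by move=> x /alphaB [].
have phi_alpha v : eval v phi -> eval v alpha.
  by move=> phiv; apply/alphaP; exists v.
exists alpha; split=> // [s|s].
  by rewrite -(restr_extend s) !M_restr; exact: phi_alpha.
rewrite -(restr_extend s) M_restr; move: (extend s) => {}s.
move=> /(mu_M_restr le_refl le_GH3 _ alphaJ) [].
move=> /(mu_restr _ _ alphaJ) [alphas s_minJ] s_minC.
have /alphaP [t ts phit] := alphas.
have [r r_min rt] := smooth_le le_refl le_smooth (@subset_refl _ J) phit.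
have BJ : B `<=` J by move=> x [].
have tsB : restr B t = restr B s.
  apply/restr_eqP => x /set_mem [Jx px].
  by apply/ts/mem_set => -[/(_ px)].
(* The [B]-part of [r] completed by [s] is a model of [alpha] below [s]. *)
have rs : {in B, r =1 s}.
  have [phir _] := (mu_restr le r (@subset_refl _ J)).1 r_min.
  move=> x Bx; rewrite -(s_minJ (glue B r s)); last exact/mem_set/BJ/set_mem.
  - by rewrite /glue Bx.
  - rewrite (@eq_eval _ _ _ r) ?phi_alpha // => y /set_mem/alphaB By.
    by rewrite /glue mem_set.
  apply/(le_split le_GH3 _ _ BJ).
  rewrite restr_glueS //; split; last first.
    by rewrite restr_glueC //; move=> x [].
  by rewrite -tsB; have [] := (le_split le_GH3 r t BJ).1 rt.
have ws : {in vars psi, glue J r s =1 s}.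
  move=> x /set_mem px; rewrite /glue; case: ifPn => // /set_mem Jx.
  by apply/rs/mem_set.
rewrite -(eq_eval ws) -M_restr; apply: phi_psi.
apply/(mu_M_restr le_refl le_GH3 _ (@subset_refl _ J)).
rewrite restr_glueS // restr_glueC //; split=> // v vs x Jx.
by rewrite (s_minC v) // /glue memNset //; exact: set_mem.
Qed.
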